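(* $$\sum_{\pi\in\mathcal{E}_O^{N}}q^{|\pi|}=(-q;q)_\infty\sum_{n\geq0} \frac{q^{2n+1}}{1-q^{2n+1}}\frac{1}{(q^2;q^2)_n}+\frac{1}{(q;q)_\infty}-(-q;q)_\infty .$$
   Context: An overpartition is a finite non-increasing sequence of positive integers (its parts) in which the first occurrence of each number may be overlined (so for each size $t$ at most one part of size $t$ is overlined); the size of a part $t$ or $\overline{t}$ is $t$, and the weight $|\pi|$ is the sum of the sizes of the parts. $\mathcal{E}_O^{N}$ is the set of overpartitions in which at least one non-overlined part appears and the sizes of all non-overlined parts are greater than or equal to the sizes of all overlined parts (if any). Here $|q|<1$ (or $q$ is a formal variable), $(a;q)_\infty=\prod_{i=0}^{\infty}(1-aq^i)$ and $(a;q)_n=\prod_{i=0}^{n-1}(1-aq^i)$. *)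

(* Defs.v *)
From HB Require Import structures.
From mathcomp Require Import all_boot all_order all_algebra finmap.
From mathcomp Require Import boolp classical_sets filter topology sequences.
From mathcomp Require Import summability.

Set Implicit Arguments.
Unset Strict Implicit.
Unset Printing Implicit Defensive.

Import GRing.Theory.

Local Open Scope classical_set_scope.
Local Open Scope ring_scope.

(* The ring R[[q]] of formal power series; s n is the coefficient of q^n. *)
Record fps (R : Type) := Fps { fps_coef :> nat -> R }.

Lemma fpsP (R : Type) (s t : fps R) : s =1 t <-> s = t.
Proof.
by split=> [|-> //]; case: s t => [s] [t] /= st; congr Fps; apply/funext.
Qed.

HB.instance Definition _ (R : Type) := gen_eqMixin (fps R).
HB.instance Definition _ (R : Type) := gen_choiceMixin (fps R).

Section Zmodule.
Variable R : zmodType.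
Implicit Types s t u : fps R.

Definition fps_zero : fps R := Fps (fun=> 0).
Definition fps_opp s : fps R := Fps (fun n => - s n).
Definition fps_add s t : fps R := Fps (fun n => s n + t n).

Fact fps_addA : associative fps_add.
Proof. by move=> s t u; apply/fpsP => n /=; rewrite addrA. Qed.
Fact fps_addC : commutative fps_add.
Proof. by move=> s t; apply/fpsP => n /=; rewrite addrC. Qed.
Fact fps_add0 : left_id fps_zero fps_add.
Proof. by move=> s; apply/fpsP => n /=; rewrite add0r. Qed.
Fact fps_addN : left_inverse fps_zero fps_opp fps_add.
Proof. by move=> s; apply/fpsP => n /=; rewrite addNr. Qed.

HB.instance Definition _ :=
  GRing.isZmodule.Build (fps R) fps_addA fps_addC fps_add0 fps_addN.
HB.instance Definition _ := isPointed.Build (fps R) 0.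

Lemma coef_fps0 n : (0 : fps R) n = 0. Proof. by []. Qed.
Lemma coef_fpsD s t n : (s + t) n = s n + t n. Proof. by []. Qed.
Lemma coef_fpsN s n : (- s) n = - s n. Proof. by []. Qed.
Lemma coef_fpsB s t n : (s - t) n = s n - t n. Proof. by []. Qed.
Lemma coef_fps_sum I (r : seq I) (P : pred I) (F : I -> fps R) n :
  (\sum_(i <- r | P i) F i) n = \sum_(i <- r | P i) F i n.
Proof. by elim/big_rec2: _ => // i x y _ <-. Qed.

End Zmodule.

Section Ring.
Variable R : comNzRingType.
Implicit Types s t u : fps R.

Definition fps_one : fps R := Fps (fun n => (n == 0)%:R).
Definition fps_mul s t : fps R :=
  Fps (fun n => \sum_(i < n.+1) s i * t (n - i)%N).

Definition fps_trunc n s : {poly R} := \poly_(i < n.+1) s i.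

Fact coef_fps_trunc n s k : (k <= n)%N -> (fps_trunc n s)`_k = s k.
Proof. by move=> kn; rewrite coef_poly ltnS kn. Qed.

Fact coef_fps_mul n s t k : (k <= n)%N ->
  fps_mul s t k = (fps_trunc n s * fps_trunc n t)`_k.
Proof.
move=> kn; rewrite coefM; apply: eq_bigr => i _.
have ik : (i <= k)%N by rewrite -ltnS.
by rewrite !coef_fps_trunc ?(leq_trans (leq_subr _ _)) // (leq_trans ik).
Qed.

Fact fps_mulC : commutative fps_mul.
Proof.
by move=> s t; apply/fpsP => n; rewrite !(@coef_fps_mul n) // mulrC.
Qed.

Fact fps_mulA : associative fps_mul.
Proof.
move=> s t u; apply/fpsP => n; rewrite !(@coef_fps_mul n) //.
transitivity (fps_trunc n s * (fps_trunc n t * fps_trunc n u))`_n.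
  rewrite !coefM; apply: eq_bigr => i _.
  by congr (_ * _); rewrite coef_fps_trunc ?(@coef_fps_mul n) ?leq_subr.
rewrite mulrA !coefM; apply: eq_bigr => i _; congr (_ * _).
have i_n : (i <= n)%N by rewrite -ltnS.
by rewrite coef_fps_trunc ?(@coef_fps_mul n).
Qed.

Fact fps_mul1 : left_id fps_one fps_mul.
Proof.
move=> s; apply/fpsP => n /=.
rewrite big_ord_recl big1 => [|i _] /=; last by rewrite mul0r.
by rewrite mul1r subn0 addr0.
Qed.

Fact fps_mulD : left_distributive fps_mul +%R.
Proof.
move=> s t u; apply/fpsP => n /=; rewrite -big_split /=.
by apply: eq_bigr => i _; rewrite mulrDl.
Qed.

Fact fps_one_neq0 : fps_one != 0.
Proof.
by apply/eqP => /fpsP/(_ 0%N)/eqP /=; rewrite oner_eq0.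
Qed.

HB.instance Definition _ := GRing.Zmodule_isComNzRing.Build (fps R)
  fps_mulA fps_mulC fps_mul1 fps_mulD fps_one_neq0.

Lemma coef_fps1 n : (1 : fps R) n = (n == 0)%:R. Proof. by []. Qed.
Lemma coef_fpsM s t n : (s * t) n = \sum_(i < n.+1) s i * t (n - i)%N.
Proof. by []. Qed.

Definition fpsX : fps R := Fps (fun n => (n == 1)%:R).

End Ring.

Arguments fpsX : clear implicits.

Section UnitRing.
Variable R : comUnitRingType.
Implicit Types s t : fps R.

Definition fps_unit : pred (fps R) := [pred s | (s : fps R) 0%N \is a GRing.unit].

(* The list of the first n coefficients of 1 / s, obtained by solving
   s * t = 1 one coefficient at a time. *)
Fixpoint fps_inv_seq s n : seq R :=
  if n is m.+1 then
    let r := fps_inv_seq s m in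
    rcons r ((s 0%N)^-1 * ((m == 0)%:R - \sum_(i < m) r`_i * s (m - i)%N))
  else [::].

Definition fps_inv s : fps R :=
  if fps_unit s then Fps (fun n => (fps_inv_seq s n.+1)`_n) else s.

Fact size_fps_inv_seq s n : size (fps_inv_seq s n) = n.
Proof. by elim: n => //= n IHn; rewrite size_rcons IHn. Qed.

Fact nth_fps_inv_seq s n i :
  (i < n)%N -> (fps_inv_seq s n)`_i = (fps_inv_seq s i.+1)`_i.
Proof.
elim: n => // n IHn; rewrite ltnS leq_eqVlt => /predU1P[-> //|lt_in].
by rewrite [in LHS]/= nth_rcons size_fps_inv_seq lt_in IHn.
Qed.

Fact fps_mulVs : {in fps_unit, left_inverse 1 fps_inv *%R}.
Proof.
move=> s us; apply/fpsP => n; rewrite coef_fpsM coef_fps1 /fps_inv.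
rewrite (us : fps_unit s) big_ord_recr /= nth_rcons size_fps_inv_seq ltnn eqxx.
rewrite subnn mulrAC mulVr // mul1r addrC -addrA -[RHS]addr0; congr (_ + _).
apply/eqP; rewrite addrC subr_eq0; apply/eqP.
apply: eq_bigr => i _; congr (_ * _); symmetry.
exact: (nth_fps_inv_seq s (ltn_ord i)).
Qed.

Fact fps_unitP s t : t * s = 1 -> fps_unit s.
Proof.
move/fpsP/(_ 0%N); rewrite coef_fpsM big_ord1 coef_fps1 /= => ts.
by apply/unitrPr; exists (t 0%N); rewrite mulrC.
Qed.

Fact fps_inv_out : {in [predC fps_unit], fps_inv =1 id}.
Proof. by move=> s nus; rewrite /fps_inv (negbTE (nus : ~~ fps_unit s)). Qed.

HB.instance Definition _ := GRing.ComNzRing_hasMulInverse.Build (fps R)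
  fps_mulVs fps_unitP fps_inv_out.

Lemma unit_fpsE s : (s \is a GRing.unit) = (s 0%N \is a GRing.unit).
Proof. by []. Qed.

End UnitRing.

(* The q-adic topology: two series are close when their coefficients agree up
   to a large order, so u_n --> s means that each coefficient of u_n is
   eventually that of s. *)
Section Topology.
Variable R : zmodType.
Implicit Types s t : fps R.

Definition fps_ball s n : set (fps R) :=
  [set t | forall k, (k <= n)%N -> t k = s k].

Definition fps_nbhs s : set_system (fps R) := filter_from setT (fps_ball s).

HB.instance Definition _ := hasNbhs.Build (fps R) fps_nbhs.

Fact fps_nbhs_filter s : ProperFilter (nbhs s).
Proof.
apply: (filter_from_proper (D := setT)) => [|n _]; last by exists s.
apply: filter_fromT_filter; first by exists 0%N.
move=> m n; exists (maxn m n) => t st.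
by split=> k kn; apply: st; rewrite leq_max kn ?orbT.
Qed.

Fact fps_nbhs_singleton s (A : set (fps R)) : nbhs s A -> A s.
Proof. by case=> n _; apply. Qed.

Fact fps_nbhs_nbhs s (A : set (fps R)) : nbhs s A -> nbhs s (nbhs^~ A).
Proof.
case=> n _ sA; exists n => // t st; exists n => // u tu.
by apply: sA => k kn; rewrite tu ?st.
Qed.

HB.instance Definition _ := Nbhs_isNbhsTopological.Build (fps R)
  fps_nbhs_filter fps_nbhs_singleton fps_nbhs_nbhs.

Lemma fps_hausdorff : hausdorff_space (fps R).
Proof.
move=> s t st; apply/fpsP => n.
have [||u [su tu]] := st (fps_ball s n) (fps_ball t n); [by exists n..|].
by rewrite -su // tu.
Qed.

Lemma fps_cvgP (T : Type) (F : set_system T) (FF : Filter F)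
    (u : T -> fps R) s :
  (u @ F --> s) <-> forall n, \forall x \near F, u x n = s n.
Proof.
split=> [us n|us A [n _ sA]].
  have sn : nbhs s (fps_ball s n) by exists n.
  apply: (@filterS _ F _ (u @^-1` fps_ball s n)); last exact: us.
  by move=> x ux; exact: ux.
have : \forall x \near F, fps_ball s n (u x).
  elim: n {A sA} => [|n IHn].
    by near=> x => k; rewrite leqn0 => /eqP ->; near: x; apply: us.
  near=> x => k; rewrite leq_eqVlt => /predU1P[->|]; first by near: x; apply: us.
  by move: k; near: x; apply: IHn.
by apply: (@filterS _ F) => x /sA.
Unshelve. all: by end_near. Qed.

Lemma fps_is_cvg (u : nat -> fps R) :
  (forall n k, (k <= n)%N -> u n.+1 k = u n k) -> cvgn u.
Proof.
move=> uS; have uE n m k : (k <= n)%N -> u (m + n)%N k = u n k.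
  move=> kn; elim: m => // m IHm.
  by rewrite addSn uS // (leq_trans kn) // leq_addl.
apply/cvg_ex; exists (Fps (fun n => u n n)); apply/fps_cvgP => n.
by exists n => // m /= nm; rewrite -(subnK nm) uE.
Qed.

End Topology.

Definition qpoch (S : comNzRingType) (a q : S) (n : nat) : S :=
  \prod_(0 <= i < n) (1 - a * q ^+ i).

Definition qpoch_inf (R : comNzRingType) (a q : fps R) : fps R :=
  \big[*%R/1]_(0 <= i <oo) (1 - a * q ^+ i).

Section Convergence.
Variable R : comUnitRingType.
Implicit Types s t a q : fps R.

Lemma coef_fps_exp0 s n k : s 0%N = 0 -> (k < n)%N -> (s ^+ n) k = 0.
Proof.
move=> s0; elim: n k => // n IHn k kn; rewrite exprS coef_fpsM.
rewrite big_ord_recl s0 mul0r add0r big1 // => i _.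
rewrite IHn ?mulr0 //= /bump /= add1n.
by case: k kn i => [|k] kn i; [case: i | rewrite subSS (leq_ltn_trans (leq_subr _ _))].
Qed.

Lemma coef_fpsM0l s t n :
  (forall k, (k <= n)%N -> s k = 0) -> forall k, (k <= n)%N -> (s * t) k = 0.
Proof.
move=> s0 k kn; rewrite coef_fpsM big1 // => i _.
by rewrite s0 ?mul0r // (leq_trans _ kn) // -ltnS.
Qed.

Lemma is_cvg_qpoch a q : a 0%N = 0 -> q 0%N = 0 -> cvgn (qpoch a q).
Proof.
move=> a0 q0; apply: fps_is_cvg => n k kn.
have -> : qpoch a q n.+1 = qpoch a q n * (1 - a * q ^+ n).
  by rewrite /qpoch big_nat_recr.
rewrite mulrBr mulr1 coef_fpsB.
rewrite [X in _ - X](_ : _ = 0) ?subr0 // mulrC.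
apply: (@coef_fpsM0l _ _ n) => // j jn; rewrite coef_fpsM.
rewrite big_ord_recl a0 mul0r add0r big1 // => i _; rewrite coef_fps_exp0 ?mulr0 //.
rewrite /= /bump /= add1n; case: j jn i => [|j] jn i; first by case: i.
by rewrite subSS (leq_ltn_trans (leq_subr _ _)).
Qed.

Lemma qpoch_coef0 a q n : a 0%N = 0 -> qpoch a q n 0%N = 1.
Proof.
move=> a0; rewrite /qpoch; elim/big_ind: _ => // [s t s1 t1|i _].
  by rewrite coef_fpsM big_ord1 s1 t1 mulr1.
by rewrite coef_fpsB coef_fps1 coef_fpsM big_ord1 a0 mul0r subr0.
Qed.

Lemma unit_qpoch a q n : a 0%N = 0 -> qpoch a q n \is a GRing.unit.
Proof. by move=> a0; rewrite unit_fpsE qpoch_coef0 // unitr1. Qed.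

Lemma unit_qpoch_inf a q :
  a 0%N = 0 -> q 0%N = 0 -> qpoch_inf a q \is a GRing.unit.
Proof.
move=> a0 q0; rewrite unit_fpsE.
have /fps_cvgP/(_ 0%N)[N _ /(_ N (leqnn N))] := is_cvg_qpoch a0 q0.
by rewrite /= qpoch_coef0 // => qi0; rewrite -[X in X \is a _]qi0 unitr1.
Qed.

Lemma unit_fps_1subXn n : (0 < n)%N -> 1 - fpsX R ^+ n \is a GRing.unit.
Proof.
by move=> n0; rewrite unit_fpsE coef_fpsB coef_fps_exp0 // subr0 unitr1.
Qed.

Lemma is_cvg_fps_series (u : nat -> fps R) :
  (forall n k, (k <= n)%N -> u n k = 0) ->
  cvgn (fun n => \sum_(0 <= i < n) u i).
Proof.
move=> u0; apply: fps_is_cvg => n k kn.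
have -> : \sum_(0 <= i < n.+1) u i = \sum_(0 <= i < n) u i + u n.
  by rewrite big_nat_recr.
by rewrite coef_fpsD u0 // addr0.
Qed.

Lemma is_cvg_lambert_qpoch (q := fpsX R) :
  cvgn (fun n => \sum_(0 <= i < n)
    (q ^+ (2 * i + 1) / (1 - q ^+ (2 * i + 1)) * (qpoch (q ^+ 2) (q ^+ 2) i)^-1)).
Proof.
apply: is_cvg_fps_series => n k kn; rewrite -mulrA.
apply: coef_fpsM0l kn => j jn; apply: coef_fps_exp0 => //.
by rewrite addn1 ltnS (leq_trans jn) // leq_pmull.
Qed.

End Convergence.

(* A part is a pair (size, overlined?). *)
Definition is_overpartition (p : seq (nat * bool)) : bool :=
  [&& sorted geq (unzip1 p), all (leq 1) (unzip1 p) &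
      [forall i : 'I_(size p), (nth (0, false) p i).2 ==>
         ((nth (0, false) p i).1 \notin take i (unzip1 p))]]%N.

Record overpartition := Overpartition {
  parts :> seq (nat * bool);
  _ : is_overpartition parts
}.

HB.instance Definition _ := [isSub for parts].
HB.instance Definition _ := [Countable of overpartition by <:].

Definition weight (p : overpartition) : nat := sumn (unzip1 p).

Definition E_ON (p : overpartition) : bool :=
  has (fun x => ~~ x.2) p &&
  all (fun x => all (fun y => ~~ x.2 ==> y.2 ==> (y.1 <= x.1)%N) p) p.

(* Main.v *)
Require Import Defs.
From mathcomp Require Import all_boot all_order all_algebra finmap.
From mathcomp Require Import boolp classical_sets filter topology sequences.
From mathcomp Require Import summability.
From mathcomp Require Import ring zify.

Set Implicit Arguments.
Unset Strict Implicit.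
Unset Printing Implicit Defensive.

Import GRing.Theory.

Local Open Scope classical_set_scope.
Local Open Scope ring_scope.

(* Sorting the elements of E_ON by their smallest non-overlined part n, the
   generating function is the sum over n >= 1 of
     (-q;q)_n * q^n / (1 - q^n) / (q^(n+1);q)_oo
       = (q^n + q^(2n)) * (q^2;q^2)_(n-1) / (q;q)_oo.
   The summands q^(2n) (q^2;q^2)_(n-1) = (q^2;q^2)_(n-1) - (q^2;q^2)_n telescope
   and yield 1 / (q;q)_oo - (-q;q)_oo.  For the summands q^n (q^2;q^2)_(n-1),
   Euler's identity
     (q^2;q^2)_(n-1) / (q^2;q^2)_oo = 1 / (q^(2n);q^2)_oo
       = sum_m q^(2nm) / (q^2;q^2)_m
   and summation over n first give the Lambert-like series.  Modulo
   q^(N+1) all these sums and products are finite. *)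

(** * Congruence of power series modulo q^(N+1) *)

Section Truncation.
Variable R : comUnitRingType.
Implicit Types s t u a q : fps R.

(** Stated as an equality of truncated polynomials, so that reflexivity, symmetry and transitivity
    are those of equality, and products are handled in the polynomial ring. *)
Definition fps_eqmod N s t := fps_trunc N s = fps_trunc N t.

Lemma fps_eqmod_trans N t s u :
  fps_eqmod N s t -> fps_eqmod N t u -> fps_eqmod N s u.
Proof. exact: etrans. Qed.

Lemma fps_eqmodP N s t :
  fps_eqmod N s t <-> (forall k, (k <= N)%N -> s k = t k).
Proof.
split=> [st k kN|st]; first by rewrite -(coef_fps_trunc s kN) st coef_fps_trunc.
by apply/polyP => k; rewrite !coef_poly ltnS; case: leqP => // /st.
Qed.

Lemma fps_eqmodD N s s' t t' :
  fps_eqmod N s s' -> fps_eqmod N t t' -> fps_eqmod N (s + t) (s' + t').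
Proof.
move=> /fps_eqmodP ss /fps_eqmodP tt; apply/fps_eqmodP => k kN.
by rewrite !coef_fpsD ss // tt.
Qed.

Lemma fps_eqmodB N s s' t t' :
  fps_eqmod N s s' -> fps_eqmod N t t' -> fps_eqmod N (s - t) (s' - t').
Proof.
move=> /fps_eqmodP ss /fps_eqmodP tt; apply/fps_eqmodP => k kN.
by rewrite !coef_fpsB ss // tt.
Qed.

Lemma fps_eqmodM N s s' t t' :
  fps_eqmod N s s' -> fps_eqmod N t t' -> fps_eqmod N (s * t) (s' * t').
Proof.
move=> ss tt; apply/fps_eqmodP => k kN.
by rewrite !(@coef_fps_mul _ N) // ss tt.
Qed.

Lemma fps_eqmod_sum N I (r : seq I) (P : pred I) (F G : I -> fps R) :
  (forall i, P i -> fps_eqmod N (F i) (G i)) ->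
  fps_eqmod N (\sum_(i <- r | P i) F i) (\sum_(i <- r | P i) G i).
Proof. by move=> FG; elim/big_ind2: _ => // *; exact: fps_eqmodD. Qed.

Lemma fps_eqmod_prod N I (r : seq I) (P : pred I) (F G : I -> fps R) :
  (forall i, P i -> fps_eqmod N (F i) (G i)) ->
  fps_eqmod N (\prod_(i <- r | P i) F i) (\prod_(i <- r | P i) G i).
Proof. by move=> FG; elim/big_ind2: _ => // *; exact: fps_eqmodM. Qed.

Lemma fps_eqmodMI N s t u :
  u \is a GRing.unit -> fps_eqmod N (u * s) (u * t) -> fps_eqmod N s t.
Proof.
move=> uu ust; rewrite -[s](mulKr uu) -[t](mulKr uu).
exact: fps_eqmodM.
Qed.

Lemma fps_eqmodXM N n s : (N < n)%N -> fps_eqmod N (fpsX R ^+ n * s) 0.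
Proof.
move=> Nn; apply/fps_eqmodP => k kN; apply: (@coef_fpsM0l _ _ _ N) => // j jN.
by rewrite coef_fps_exp0 // (leq_ltn_trans jN).
Qed.

Lemma fps_eqmodX N n : (N < n)%N -> fps_eqmod N (fpsX R ^+ n) 0.
Proof. by move=> Nn; rewrite -[fpsX R ^+ n]mulr1; exact: fps_eqmodXM. Qed.

Lemma coef_fpsXn n k : (fpsX R ^+ n) k = (k == n)%:R.
Proof.
elim: n k => [|n IHn] k; first by rewrite expr0 coef_fps1.
rewrite exprS coef_fpsM big_ord_recl mul0r add0r.
case: k => [|k]; first by rewrite big_ord0.
rewrite big_ord_recl big1 => [|i _]; last by rewrite mul0r.
by rewrite /= mul1r addr0 /bump /= subSS subn0 IHn eqSS.
Qed.

(** From stage N on, each step only alters coefficients of order above N, so the coefficients up to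
    N are already those of the limit. *)
Lemma fps_limn_eqmod (u : nat -> fps R) N :
  (forall n, fps_eqmod n (u n.+1) (u n)) -> fps_eqmod N (limn u) (u N).
Proof.
move=> /(_ _)/fps_eqmodP uS; apply/fps_eqmodP => k kN.
have /fps_cvgP/(_ k)[M _ uM] := fps_is_cvg uS.
have uE m : u (m + N)%N k = u N k.
  by elim: m => // m IHm; rewrite addSn uS // (leq_trans kN) ?leq_addl.
by rewrite -(uM (M + N)%N) ?uE //= leq_addr.
Qed.

(** The factor of index n is 1 - a q^(n+1), hence 1 modulo q^(n+1). The values a = 1 and a = -1 give
    (q;q)_oo and (-q;q)_oo. *)
Lemma qpoch_inf_eqmod a N :
  fps_eqmod N (qpoch_inf (fpsX R * a) (fpsX R)) (qpoch (fpsX R * a) (fpsX R) N).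
Proof.
apply: (@fps_limn_eqmod (qpoch (fpsX R * a) (fpsX R))) => n.
rewrite /qpoch big_nat_recr //= -[X in fps_eqmod _ _ X]mulr1.
apply: fps_eqmodM => //; rewrite -[X in fps_eqmod _ _ X]subr0.
apply: fps_eqmodB => //; rewrite mulrAC -exprS.
exact: fps_eqmodXM.
Qed.

(** * Euler's expansion and the Lambert-like series modulo q^(N+1) *)

Local Notation q := (fpsX R).

Lemma geom_fps_eqmod N n :
  fps_eqmod N (q ^+ n.+1 / (1 - q ^+ n.+1))
    (\sum_(0 <= i < N) q ^+ (n.+1 * i.+1)).
Proof.
apply: (@fps_eqmodMI _ _ _ (1 - q ^+ n.+1)); first exact: unit_fps_1subXn.
rewrite mulrC divrK ?unit_fps_1subXn // mulr_sumr.
(* After multiplication by 1 - q^(n+1) the sum telescopes; the leftover power q^((n+1)(N+1))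
   vanishes modulo q^(N+1). *)
rewrite (telescope_sumr_eq (fun i => - q ^+ (n.+1 * i.+1))) // => [|i _].
  rewrite muln1 opprK addrC -[X in fps_eqmod _ X]subr0.
  apply: fps_eqmodB => //; apply: esym; apply: fps_eqmodX.
  by rewrite leq_pmull.
rewrite mulrBl mul1r -exprD opprK [RHS]addrC; congr (_ - q ^+ _).
by rewrite -mulnS.
Qed.

(* Euler's expansion of [1 / (q^(2n); q^2)_oo], truncated at [M] terms. *)
Definition euler_sum M n :=
  \sum_(0 <= m < M) q ^+ (2 * n * m) / qpoch (q ^+ 2) (q ^+ 2) m.

Lemma qpochS a t n : qpoch a t n.+1 = qpoch a t n * (1 - a * t ^+ n).
Proof. by rewrite /qpoch big_nat_recr. Qed.

Lemma unit_qpochq2 n : qpoch (q ^+ 2) (q ^+ 2) n \is a GRing.unit.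
Proof. by apply: unit_qpoch; rewrite coef_fps_exp0. Qed.

(** This is the functional equation of 1 / (q^(2n);q^2)_oo. In the difference of the two sums the
    terms of index m carry a factor 1 - q^(2m), which cancels the last factor of (q^2;q^2)_m and
    shifts m by one. *)
Lemma euler_sumS N n :
  fps_eqmod N (euler_sum N.+1 n.+2) ((1 - (q ^+ 2) ^+ n.+1) * euler_sum N.+1 n.+1).
Proof.
suff : fps_eqmod N (euler_sum N.+1 n.+1 - euler_sum N.+1 n.+2)
                 ((q ^+ 2) ^+ n.+1 * euler_sum N.+1 n.+1).
  move=> h; rewrite mulrBl mul1r -[euler_sum _ n.+2](subKr (euler_sum N.+1 n.+1)).
  exact: fps_eqmodB.
rewrite {1 2}/euler_sum -sumrB big_nat_recl // !muln0 subrr add0r.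
rewrite /euler_sum mulr_sumr big_nat_recr //= -[X in fps_eqmod _ X]addr0.
apply: fps_eqmodD.
  rewrite big_nat [X in fps_eqmod _ _ X]big_nat.
  apply: fps_eqmod_sum => i _.
  rewrite qpochS -mulrBl -!exprM -exprD.
  have -> : q ^+ (2 * n.+1 * i.+1) - q ^+ (2 * n.+2 * i.+1)
    = q ^+ (2 * n.+1 + 2 * n.+1 * i) * (1 - q ^+ (2 + 2 * i)).
    by rewrite mulrBr mulr1 -exprD; congr (q ^+ _ - q ^+ _); ring.
  rewrite invrM ?unit_qpochq2 ?unit_fps_1subXn // !mulrA mulrK ?unit_fps_1subXn //.
  by rewrite exprD.
(* The term of index N on the right has no partner on the left, but its order is at least 2(N+1). *)
apply: esym; rewrite mulrA -!exprM -exprD; apply: fps_eqmodXM.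
by rewrite -mulnS leq_pmull.
Qed.

Lemma euler_sum_qpoch N n :
  fps_eqmod N (euler_sum N.+1 n.+1)
    (euler_sum N.+1 1 * qpoch (q ^+ 2) (q ^+ 2) n).
Proof.
elim: n => [|n IHn]; first by rewrite /qpoch big_nil mulr1.
rewrite qpochS mulrA; apply: fps_eqmod_trans (euler_sumS _ _) _.
by rewrite mulrC -exprS; apply: fps_eqmodM.
Qed.

(** Every term with m > 0 has order at least 2(N+1). Together with [euler_sum_qpoch] at n = N, this
    makes [euler_sum N.+1 1] an inverse of (q^2;q^2)_N modulo q^(N+1). *)
Lemma euler_sum_eqmod1 N : fps_eqmod N (euler_sum N.+1 N.+1) 1.
Proof.
rewrite /euler_sum big_nat_recl // muln0 expr0 /qpoch big_nil divr1.
rewrite -[X in fps_eqmod _ _ X]addr0; apply: fps_eqmodD => //.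
rewrite -[X in fps_eqmod _ _ X](@big1_eq _ _ +%R _ (index_iota 0 N) predT).
apply: fps_eqmod_sum => i _; apply: fps_eqmodXM.
by rewrite -mulnA mulnCA leq_pmulr.
Qed.

(** Expanding q^(2m+1) / (1 - q^(2m+1)) as a geometric series and exchanging the sums, the inner
    sums over m become Euler sums, each proportional to [euler_sum N.+1 1]; multiplying by
    (q^2;q^2)_N cancels this common factor. *)
Lemma lambert_eqmod N :
  fps_eqmod N
    (qpoch (q ^+ 2) (q ^+ 2) N * \sum_(0 <= n < N)
       (q ^+ (2 * n + 1) / (1 - q ^+ (2 * n + 1)) *
        (qpoch (q ^+ 2) (q ^+ 2) n)^-1))
    (\sum_(0 <= n < N) q ^+ n.+1 * qpoch (q ^+ 2) (q ^+ 2) n).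
Proof.
set D := qpoch _ _; set S := \sum_(0 <= n < N) _.
have S1 : fps_eqmod N S (\sum_(0 <= n < N) q ^+ n.+1 * euler_sum N.+1 n.+1).
  (* One more term, of order 2N+1, is added to match the N+1 terms of [euler_sum N.+1]. *)
  have S2 : fps_eqmod N S (\sum_(0 <= m < N.+1)
       (q ^+ (2 * m + 1) / (1 - q ^+ (2 * m + 1)) * (D m)^-1)).
    rewrite [X in fps_eqmod _ _ X]big_nat_recr //= -[X in fps_eqmod _ X]addr0.
    apply: fps_eqmodD => //; apply: esym; rewrite -mulrA.
    by apply: fps_eqmodXM; rewrite addn1 ltnS leq_pmull.
  apply: fps_eqmod_trans S2 _.
  under [X in fps_eqmod _ _ X]eq_bigr do rewrite mulr_sumr.
  rewrite exchange_big /=; apply: fps_eqmod_sum => m _.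
  under [X in fps_eqmod _ _ X]eq_bigr do rewrite mulrA.
  rewrite -mulr_suml; apply: fps_eqmodM => //.
  rewrite addn1; apply: fps_eqmod_trans (geom_fps_eqmod _ _) _.
  apply: fps_eqmod_sum => i _; rewrite -exprD.
  by rewrite (_ : _ * _ = i.+1 + 2 * i.+1 * m)%N //; ring.
have DE : fps_eqmod N (D N * euler_sum N.+1 1) 1.
  rewrite mulrC; apply: fps_eqmod_trans (euler_sum_eqmod1 N).
  exact/esym/euler_sum_qpoch.
apply: (@fps_eqmod_trans _ (D N * (euler_sum N.+1 1 * \sum_(0 <= n < N) q ^+ n.+1 * D n))).
  apply: fps_eqmodM => //; apply: fps_eqmod_trans S1 _; rewrite mulr_sumr.
  apply: fps_eqmod_sum => n _; rewrite mulrCA; apply: fps_eqmodM => //.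
  exact: euler_sum_qpoch.
by rewrite mulrA -[X in fps_eqmod _ _ X]mul1r; apply: fps_eqmodM.
Qed.

End Truncation.

(** * Overpartitions and multiplicities *)

Section Overpartitions.
Local Open Scope nat_scope.
Implicit Types (s : seq (nat * bool)) (f : nat -> nat * bool).

(* [x] may be followed by [y] in an overpartition; thus no overlined part is
   related to itself. *)
Definition part_rel (x y : nat * bool) := (y.1 < x.1) || (y.1 == x.1) && ~~ y.2.

Lemma part_rel_trans : transitive part_rel.
Proof. by move=> [b y] [a x] [c z]; rewrite /part_rel /=; case: x y z => [] [] []; lia. Qed.

Lemma part_rel_anti : antisymmetric part_rel.
Proof.
move=> [a x] [b y] xy; have ab : a = b by move: xy; rewrite /part_rel /=; lia.
by move: xy; rewrite ab /part_rel /= !eqxx ltnn; case: x y => [] [].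
Qed.

(** An overlined part must not be preceded by a part of its size, which is a pairwise condition and
    merges with monotonicity into [part_rel]. Sortedness for this antisymmetric relation lets a list
    be recovered from its multiplicities. *)
Lemma is_overpartitionE s :
  is_overpartition s = sorted part_rel s && all (fun x => 0 < x.1) s.
Proof.
rewrite /is_overpartition all_map andbA andbAC.
congr (_ && _); rewrite sorted_pairwise; last by move=> ? ? ? /= *; lia.
rewrite (sorted_pairwise part_rel_trans) pairwise_map.
apply/andP/idP => [[/(pairwiseP (0, false)) geqs /forallP overl]|].
  apply/(pairwiseP (0, false)) => i j; rewrite !inE => i_s j_s ij.
  have /= := geqs i j i_s j_s ij; rewrite /part_rel leq_eqVlt.
  case/predU1P => [eq_ij|->//]; rewrite eq_ij eqxx ltnn /=.
  apply/negP => j_o; have /implyP/(_ j_o)/negP := overl (Ordinal j_s); apply => /=.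
  rewrite eq_ij -(nth_map _ 0) // -(@nth_take j) //.
  by rewrite mem_nth // size_take size_map j_s.
move=> /(pairwiseP (0, false)) rel_s; split.
  apply/(pairwiseP (0, false)) => i j i_s j_s ij /=.
  by have := rel_s i j i_s j_s ij; rewrite /part_rel; lia.
apply/forallP => j; apply/implyP => j_o; apply/negP => /(nthP 0)[i].
rewrite size_take size_map ltn_ord => ij; rewrite nth_take // (nth_map (0, false)).
  move=> eq_ij; have := rel_s i j _ _ ij; rewrite !inE.
  rewrite ltn_ord (ltn_trans ij) // => /(_ isT isT).
  by rewrite /part_rel eq_ij j_o ltnn andbF.
exact: ltn_trans ij _.
Qed.

Lemma count_overlined s k :
  sorted part_rel s -> count_mem (k, true) s = ((k, true) \in s).
Proof.
rewrite (sorted_pairwise part_rel_trans).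
elim: s => //= x s IHs /andP[/allP xs /IHs ->]; rewrite inE eq_sym.
case: eqP => //= xE; case: (boolP (_ \in s)) => // /xs.
by rewrite -xE /part_rel /= ltnn andbF.
Qed.

(* The overpartition in which the size [i.+1], for [i < M], occurs [(f i).1]
   times non-overlined, and overlined iff [(f i).2]. *)
Fixpoint mult_parts f M : seq (nat * bool) :=
  if M is m.+1 then
    nseq (f m).2 (m.+1, true) ++ nseq (f m).1 (m.+1, false) ++ mult_parts f m
  else [::].

Lemma mult_parts_bound f M x : x \in mult_parts f M -> 0 < x.1 <= M.
Proof.
elim: M => //= M IHM; rewrite !mem_cat.
by case/or3P => [/nseqP[-> _]|/nseqP[-> _]|/IHM]; rewrite /= ?ltnSn //; lia.
Qed.

Lemma mult_parts_overpartition f M : is_overpartition (mult_parts f M).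
Proof.
rewrite is_overpartitionE; apply/andP; split; last first.
  by apply/allP => x /mult_parts_bound /andP[].
rewrite (sorted_pairwise part_rel_trans); elim: M => //= M IHM.
have M_ge x : x \in mult_parts f M -> x.1 < M.+1.
  by move=> /mult_parts_bound; lia.
rewrite !pairwise_cat IHM andbT; apply/and4P; split.
- apply/allrelP => x y /nseqP[-> _]; rewrite mem_cat => /orP[/nseqP[-> _]|/M_ge].
    by rewrite /part_rel /= eqxx orbT.
  by rewrite /part_rel /= => ->.
- by case: (f M).2.
- by apply/allrelP => x y /nseqP[-> _] /M_ge; rewrite /part_rel /= => ->.
- elim: (f M).1 => //= n ->; rewrite andbT; apply/allP => x /nseqP[-> _].
  by rewrite /part_rel /= eqxx orbT.
Qed.

Lemma count_mult_parts f M k b :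
  count_mem (k.+1, b) (mult_parts f M) =
  if k < M then (if b then nat_of_bool (f k).2 else (f k).1) else 0.
Proof.
elim: M => //= M IHM; rewrite !count_cat !count_nseq IHM /=.
rewrite !xpair_eqE eqSS ltnS [k <= M]leq_eqVlt [k == M]eq_sym.
case: eqP => [->|_] /=; last by rewrite !mul0n.
by rewrite ltnn; case: (b) => /=; lia.
Qed.

Lemma mem_mult_parts f M k b :
  k < M -> ((k.+1, b) \in mult_parts f M) = (if b then (f k).2 else (f k).1 != 0).
Proof.
move=> kM; rewrite -has_pred1 has_count count_mult_parts kM.
by case: b; [case: (f k).2 | rewrite lt0n].
Qed.

Lemma sumn_mult_parts f M :
  sumn (unzip1 (mult_parts f M)) = \sum_(i < M) i.+1 * ((f i).1 + (f i).2).
Proof.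
elim: M => [|M IHM]; first by rewrite big_ord0.
rewrite big_ord_recr /= /unzip1 !map_cat !sumn_cat !map_nseq !sumn_nseq /=.
by rewrite -/(unzip1 _) IHM addnA -mulnDr addnC [(_ + (f M).1)%N]addnC.
Qed.

(** The witness is the smallest non-overlined size, the parameter by which these overpartitions are
    classified. *)
Lemma E_ONP (p : overpartition) :
  E_ON p <-> exists n, [/\ (n, false) \in parts p,
    forall k, (k, false) \in parts p -> n <= k &
    forall k, (k, true) \in parts p -> k <= n].
Proof.
split=> [/andP[/hasP[[m []]// mp _] /allP Ep]|[n [np n_min n_max]]].
  have exn : exists k, (k, false) \in parts p by exists m.
  exists (ex_minn exn); case: ex_minnP => n np n_min; split=> // k kp.
  by have /allP/(_ _ kp) := Ep _ np.
apply/andP; split; first by apply/hasP; exists (n, false).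
apply/allP => -[a []] ap; apply/allP => -[b []] bp //=.
by rewrite (leq_trans (n_max _ bp)) ?n_min.
Qed.

(** * Encoding by finite multiplicity functions *)

Variable N : nat.
Implicit Types (n : 'I_N) (g : {ffun 'I_N -> 'I_N.+1 * bool}).

(* The multiplicities allowed for the size [i.+1] in an element of E_ON whose
   smallest non-overlined part is [n.+1]. *)
Definition nonoverl_ok (n i : nat) (a : nat) :=
  if i < n then a == 0 else (i == n) ==> (a != 0).
Definition overl_ok (n i : nat) (b : bool) := b ==> (i <= n).
Definition mult_ok n (i : 'I_N) : pred ('I_N.+1 * bool) :=
  [pred x : 'I_N.+1 * bool | nonoverl_ok n i x.1 && overl_ok n i x.2].

(** Extends g to all naturals, as [mult_parts] expects; [mult_parts] with bound N never reads the
    default (0, false). *)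
Definition mult_fun g (i : nat) : nat * bool :=
  oapp (fun i => (val (g i).1, (g i).2)) (0, false) (insub i).

Lemma mult_funE g (i : 'I_N) : mult_fun g i = (val (g i).1, (g i).2).
Proof. by rewrite /mult_fun valK. Qed.

Definition ffun_parts g := mult_parts (mult_fun g) N.

Lemma ffun_parts_inj : injective ffun_parts.
Proof.
move=> g h gh; apply/ffunP => i.
have gh_i b : count_mem (i.+1, b) (ffun_parts g) = count_mem (i.+1, b) (ffun_parts h).
  by rewrite gh.
have := gh_i false; have := gh_i true.
rewrite !count_mult_parts ltn_ord !mult_funE /= => gh2 gh1.
apply/eqP; rewrite -pair_eqE /pair_eq -val_eqE /= gh1 eqxx /=.
by case: (g i).2 (h i).2 gh2 => [] [].
Qed.

Lemma mem_ffun_parts g (i : 'I_N) b :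
  ((i.+1, b) \in ffun_parts g) = (if b then (g i).2 else (val (g i).1 != 0)).
Proof. by rewrite mem_mult_parts // mult_funE. Qed.

Lemma ffun_parts_ord g k b : (k, b) \in ffun_parts g -> exists i : 'I_N, k = i.+1.
Proof.
move=> /mult_parts_bound /= /andP[k0 kN].
have kN' : k.-1 < N by lia.
by exists (Ordinal kN') => /=; lia.
Qed.

Lemma family_mult_okP n g :
  reflect [/\ (n.+1, false) \in ffun_parts g,
    forall k, (k, false) \in ffun_parts g -> n.+1 <= k &
    forall k, (k, true) \in ffun_parts g -> k <= n.+1]
  (g \in family (mult_ok n)).
Proof.
apply: (iffP familyP) => [g_ok|[gn n_min n_max] i].
  split=> [|k kg|k kg].
  - rewrite mem_ffun_parts; have := g_ok n; rewrite inE /nonoverl_ok ltnn eqxx.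
    by case/andP.
  - have [i ki] := ffun_parts_ord kg; move: kg; rewrite ki mem_ffun_parts.
    have := g_ok i; rewrite inE /nonoverl_ok.
    by case: (ltnP i n) => //= _ /andP[->].
  - have [i ki] := ffun_parts_ord kg; move: kg; rewrite ki mem_ffun_parts.
    by have := g_ok i; rewrite inE /overl_ok => /andP[_ /implyP h] /h.
rewrite inE; apply/andP; split.
  rewrite /nonoverl_ok; case: ltnP => [i_n|_].
    apply: contraLR i_n => gi; rewrite -leqNgt -ltnS.
    by apply: n_min; rewrite mem_ffun_parts.
  by apply/implyP => /eqP/val_inj ->; rewrite mem_ffun_parts in gn.
by apply/implyP => gi; rewrite -ltnS; apply: n_max; rewrite mem_ffun_parts.
Qed.

Lemma family_mult_ok_inj n n' g :
  g \in family (mult_ok n) -> g \in family (mult_ok n') -> n = n'.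
Proof.
move=> /family_mult_okP[gn n_min _] /family_mult_okP[gn' n_min' _].
apply/val_inj/eqP; rewrite eqn_leq -ltnS -[X in _ && X]ltnS.
by rewrite n_min // n_min'.
Qed.

(** In weight N, sizes and multiplicities are at most N, so a function from ['I_N] to
    ['I_N.+1 * bool] records the whole overpartition. *)
Lemma ffun_parts_surj (p : overpartition) :
  E_ON p -> weight p = N ->
  exists n g, g \in family (mult_ok n) /\ parts p = ffun_parts g.
Proof.
move=> /E_ONP[n [np n_min n_max]] wp.
have : is_overpartition p by case: (p).
rewrite is_overpartitionE => /andP[p_sorted /allP p_gt0].
have size_le k b : (k, b) \in parts p -> k <= N.
  rewrite -wp /weight => /(map_f fst) /=.
  rewrite -/(unzip1 _); elim: (unzip1 _) => //= a s IHs.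
  by rewrite inE => /predU1P[->|/IHs]; lia.
have count_le x : count_mem x (parts p) <= N.
  apply: leq_trans (count_size _ _) _; rewrite -wp /weight.
  elim: (parts p) p_gt0 => //= a s IHs s0; rewrite -add1n leq_add ?s0 ?mem_head //.
  by apply: IHs => y ys; apply: s0; rewrite inE ys orbT.
pose g : {ffun 'I_N -> 'I_N.+1 * bool} :=
  [ffun i : 'I_N => (inord (count_mem (i.+1, false) (parts p)), (i.+1, true) \in parts p)].
have pg : parts p = ffun_parts g.
  (* Both lists are sorted for an antisymmetric relation, so equal multiplicities suffice. Size 0
     occurs in neither. *)
  apply: (sorted_eq part_rel_trans part_rel_anti) => //.
    by have := mult_parts_overpartition (mult_fun g) N; rewrite is_overpartitionE => /andP[].
  apply/allP => -[[|k] b] _ /=; apply/eqP.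
    rewrite !(count_memPn _) //; apply/negP; first by move=> /mult_parts_bound.
    by move=> /p_gt0.
  rewrite count_mult_parts; case: ltnP => [kN|kN]; last first.
    by rewrite (count_memPn _) //; apply/negP => /size_le; rewrite ltnNge kN.
  rewrite -[k]/(val (Ordinal kN)) mult_funE ffunE /=.
  by case: b; rewrite ?count_overlined // inordK // ltnS.
have [n' nE] := ffun_parts_ord (eq_ind _ (fun s => _ \in s) np _ pg).
by exists n', g; split=> //; apply/family_mult_okP; rewrite -pg -nE.
Qed.

End Overpartitions.

(** * The generating function *)

Section GeneratingFunction.
Variables (R : comUnitRingType) (N : nat).
Local Notation q := (fpsX R).
Implicit Types (n i : 'I_N) (g : {ffun 'I_N -> 'I_N.+1 * bool}).

(* Only the coefficient of [q ^+ N] is meaningful: the sizes and multiplicities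
   of the parts are bounded by [N]. *)
Definition E_ON_gf : fps R :=
  \sum_(n < N) \sum_(g in family (@mult_ok N n)) q ^+ sumn (unzip1 (ffun_parts g)).

Lemma geom_fpsX_sum (k m : nat) :
  (1 - q ^+ k) * \sum_(a < m) q ^+ (k * a) = 1 - q ^+ (k * m).
Proof.
rewrite -[1 - q ^+ (k * m)]opprB exprM subrX1 -mulNr opprB.
by congr (_ * _); apply: eq_bigr => i _; rewrite exprM.
Qed.

(** Contribution of the size i+1 times 1 - q^(i+1), with x = q^(i+1): (1 - x)(1 + x) below the
    smallest non-overlined part, x(1 + x) at it, and 1 above it. *)
Definition part_factor (n i : nat) : fps R :=
  if (i < n)%N then 1 - (q ^+ 2) ^+ i.+1
  else if i == n then q ^+ i.+1 + (q ^+ 2) ^+ i.+1 else 1.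

Lemma part_factor_eqmod n i :
  fps_eqmod N
    ((1 - q ^+ i.+1) * \sum_(x | mult_ok n i x) q ^+ (i.+1 * (x.1 + x.2)))
    (part_factor n i).
Proof.
have -> : \sum_(x | mult_ok n i x) q ^+ (i.+1 * (x.1 + x.2)) =
    (\sum_(a < N.+1 | nonoverl_ok n i a) q ^+ (i.+1 * a)) *
    \sum_(b | overl_ok n i b) q ^+ (i.+1 * b).
  rewrite big_distrlr pair_big_dep /=; apply: eq_bigr => x _.
  by rewrite mulnDr exprD.
have geomN : fps_eqmod N ((1 - q ^+ i.+1) * \sum_(a < N.+1) q ^+ (i.+1 * a)) 1.
  rewrite geom_fpsX_sum -[X in fps_eqmod _ _ X]subr0; apply: fps_eqmodB => //.
  by apply: fps_eqmodX; rewrite leq_pmull.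
rewrite mulrA /nonoverl_ok /overl_ok /part_factor.
have sum_bool (P : pred bool) : \sum_(b | P b) q ^+ (i.+1 * b) =
    (if P true then q ^+ i.+1 else 0) + (if P false then 1 else 0).
  by rewrite big_mkcond big_bool /= muln1 muln0.
case: ltngtP => [i_n|n_i|i_n].
- rewrite (big_pred1 ord0) // muln0 expr0 mulr1 sum_bool /=.
  by rewrite -exprM mulnC exprM; congr fps_trunc; ring.
- by rewrite sum_bool /= add0r mulr1.
- rewrite sum_bool /= -exprM mulnC exprM.
  have -> : q ^+ i.+1 + (q ^+ i.+1) ^+ 2 = q ^+ i.+1 * 1 * (q ^+ i.+1 + 1) by ring.
  apply: fps_eqmodM => //.
  apply: (@fps_eqmod_trans _ _ (q ^+ i.+1 *
    ((1 - q ^+ i.+1) * \sum_(a < N.+1) q ^+ (i.+1 * a)))); last exact: fps_eqmodM.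
  (* The smallest non-overlined part occurs at least once: dropping a = 0 and shifting takes out a
     factor q^(i+1), up to a term of order (i+1)(N+1). *)
  rewrite big_mkcond big_ord_recl /= add0r.
  rewrite mulrCA; apply: fps_eqmodM => //.
  rewrite big_ord_recr /= mulrDr mulr_sumr -[X in fps_eqmod _ X _]addr0.
  apply: fps_eqmodD; last first.
    by apply: esym; rewrite -exprD -mulnS; apply: fps_eqmodX; rewrite leq_pmull.
  by congr fps_trunc; apply: eq_bigr => a _; rewrite -exprD -mulnS.
Qed.

Lemma prod_part_factor n :
  \prod_(i < N) part_factor n i =
  (q ^+ n.+1 + (q ^+ 2) ^+ n.+1) * qpoch (q ^+ 2) (q ^+ 2) n.
Proof.
rewrite -(big_mkord predT (part_factor n)) (big_cat_nat (n := n)) //=; last exact: ltnW.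
rewrite mulrC big_ltn // /part_factor ltnn eqxx.
rewrite -[X in _ = X * _]mulr1; congr (_ * _ * _).
  rewrite big_nat big1 // => i /andP[n_i _].
  by case: ltngtP n_i.
rewrite /qpoch big_nat [RHS]big_nat; apply: eq_bigr => i /andP[_ ->].
by rewrite -exprS.
Qed.

(** For a fixed smallest non-overlined part the multiplicities of distinct sizes are independent, so
    the sum over the family is a product over sizes, matched factor by factor with (q;q)_N. *)
Lemma E_ON_gf_eqmod :
  fps_eqmod N (qpoch q q N * E_ON_gf)
    (\sum_(0 <= n < N)
       (q ^+ n.+1 + (q ^+ 2) ^+ n.+1) * qpoch (q ^+ 2) (q ^+ 2) n).
Proof.
rewrite big_mkord mulr_sumr; apply: fps_eqmod_sum => n _.
rewrite -prod_part_factor.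
have -> : \sum_(g in family (@mult_ok N n)) q ^+ sumn (unzip1 (ffun_parts g)) =
    \prod_(i < N) \sum_(x | mult_ok n i x) q ^+ (i.+1 * (x.1 + x.2)).
  rewrite bigA_distr_big_dep; apply: eq_bigr => g _.
  rewrite sumn_mult_parts expr_sum; apply: eq_bigr => i _.
  by rewrite mult_funE.
rewrite /qpoch big_mkord -big_split /=; apply: fps_eqmod_prod => i _.
by rewrite -exprS; exact: part_factor_eqmod.
Qed.

Lemma telescope_qpochq2 :
  \sum_(0 <= k < N) (q ^+ 2) ^+ k.+1 * qpoch (q ^+ 2) (q ^+ 2) k =
  1 - qpoch (q ^+ 2) (q ^+ 2) N.
Proof.
rewrite (telescope_sumr_eq (fun k => - qpoch (q ^+ 2) (q ^+ 2) k)) //.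
  by rewrite [qpoch _ _ 0]big_nil opprK addrC.
by move=> n _; rewrite qpochS exprS; ring.
Qed.

Lemma qpochqN : qpoch (- q) q N * qpoch q q N = qpoch (q ^+ 2) (q ^+ 2) N.
Proof.
rewrite -big_split; apply: eq_bigr => i _ /=.
by rewrite -exprM mulnC exprM; ring.
Qed.

Lemma E_ON_gf_limit :
  fps_eqmod N E_ON_gf
   (qpoch_inf (- q) q *
    (\big[+%R/0]_(0 <= n <oo)
       (q ^+ (2 * n + 1) / (1 - q ^+ (2 * n + 1)) *
        (qpoch (q ^+ 2) (q ^+ 2) n)^-1))
  + (qpoch_inf q q)^-1 - qpoch_inf (- q) q).
Proof.
set S := limn _.
have Q_unit : qpoch_inf q q \is a GRing.unit by exact: unit_qpoch_inf.
apply: (fps_eqmodMI Q_unit).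
(* With P = (-q;q)_oo and Q = (q;q)_oo, the right side times Q is PQ S + 1 - PQ, where PQ is
   (q^2;q^2)_N modulo q^(N+1). *)
rewrite mulrBr mulrDr divrr // mulrA [_ * qpoch_inf (- q) q]mulrC.
have QN : fps_eqmod N (qpoch_inf q q) (qpoch q q N).
  by have := qpoch_inf_eqmod (1 : fps R) N; rewrite mulr1.
have PN : fps_eqmod N (qpoch_inf (- q) q) (qpoch (- q) q N).
  by have := qpoch_inf_eqmod (-1 : fps R) N; rewrite mulrN1.
have PQ : fps_eqmod N (qpoch_inf (- q) q * qpoch_inf q q) (qpoch (q ^+ 2) (q ^+ 2) N).
  by rewrite -qpochqN; apply: fps_eqmodM.
have SN : fps_eqmod N S (\sum_(0 <= n < N)
       (q ^+ (2 * n + 1) / (1 - q ^+ (2 * n + 1)) *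
        (qpoch (q ^+ 2) (q ^+ 2) n)^-1)).
  apply: (@fps_limn_eqmod _ (fun N => \sum_(0 <= n < N)
       (q ^+ (2 * n + 1) / (1 - q ^+ (2 * n + 1)) *
        (qpoch (q ^+ 2) (q ^+ 2) n)^-1))) => n.
  rewrite big_nat_recr //= -[X in fps_eqmod _ _ X]addr0.
  apply: fps_eqmodD => //; rewrite -mulrA; apply: fps_eqmodXM.
  by rewrite addn1 ltnS leq_pmull.
apply: (@fps_eqmod_trans _ _ (qpoch q q N * E_ON_gf)); first exact: fps_eqmodM.
apply: fps_eqmod_trans E_ON_gf_eqmod _.
(* The q^(2n+2) summands telescope to 1 - PQ modulo q^(N+1); the q^(n+1) summands give PQ S. *)
under eq_bigr do rewrite mulrDl.
rewrite big_split /= telescope_qpochq2 addrA.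
apply: esym; apply: fps_eqmodB => //; apply: fps_eqmodD => //.
apply: fps_eqmod_trans (lambert_eqmod _ _).
exact: fps_eqmodM.
Qed.

End GeneratingFunction.

(** * Listing the overpartitions of weight N and comparing coefficients *)

Section Counting.
Variable N : nat.
Local Open Scope nat_scope.

(** The index n is kept so that these pairs index the double sum [E_ON_gf]; it is determined by the
    function, so nothing is listed twice. *)
Definition marked_mults : pred ('I_N * {ffun 'I_N -> 'I_N.+1 * bool}) :=
  [pred z | (z.2 \in family (@mult_ok N z.1)) &&
            (sumn (unzip1 (ffun_parts z.2)) == N)].

Definition E_ON_list : seq (seq (nat * bool)) :=
  [seq ffun_parts z.2 | z in marked_mults].

Lemma E_ON_list_uniq : uniq E_ON_list.
Proof.
rewrite map_inj_in_uniq ?enum_uniq // => -[n g] [n' g'].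
rewrite !mem_enum !inE /= => /andP[ng _] /andP[n'g' _] /ffun_parts_inj gg'.
by rewrite -gg' in n'g' *; rewrite (family_mult_ok_inj ng n'g').
Qed.

Lemma E_ON_listP s :
  reflect (exists p : overpartition, [/\ E_ON p, weight p = N & s = parts p])
    (s \in E_ON_list).
Proof.
apply: (iffP mapP) => [[[n g]]|[p [Ep wp ->]]].
  rewrite mem_enum => /andP[/= ng /eqP gN] ->.
  exists (Overpartition (mult_parts_overpartition (mult_fun g) N)).
  split=> //; apply/E_ONP; exists n.+1.
  exact/family_mult_okP.
have [n [g [ng pg]]] := ffun_parts_surj Ep wp.
exists (n, g) => //; rewrite mem_enum inE /= ng /=; apply/eqP.
by rewrite -pg.
Qed.

(** The inner [insub] turns lists into overpartitions, the outer one puts these into the subtype of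
    [E_ON]. *)
Definition E_ON_seq : seq {p : overpartition | E_ON p} :=
  pmap insub (pmap insub E_ON_list).

Lemma mem_E_ON_seq (p : {p : overpartition | E_ON p}) :
  (p \in E_ON_seq) = (weight (val p) == N).
Proof.
rewrite !mem_pmap_sub; apply/E_ON_listP/eqP => [[p' [_ wp' pp']]|wp].
  by rewrite (val_inj pp').
by exists (val p); split=> //; exact: valP p.
Qed.

Lemma E_ON_list_parts (A : {fset {p : overpartition | E_ON p}}) :
  (forall p, weight (val p) = N -> p \in A) ->
  perm_eq [seq parts (val p) | p <- [seq p <- A | weight (val p) == N]] E_ON_list.
Proof.
move=> AN; apply: uniq_perm; last 1 first.
- move=> s; apply/mapP/E_ON_listP => [[p]|[p [Ep wp ->]]].
    by rewrite mem_filter => /andP[/eqP wp _] ->; exists (val p); split=> //; exact: valP p.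
  exists (exist _ p Ep) => //; rewrite mem_filter /= wp eqxx /=.
  exact: AN.
- rewrite map_inj_uniq ?filter_uniq ?fset_uniq //.
  by move=> p p' /val_inj/val_inj.
- exact: E_ON_list_uniq.
Qed.

End Counting.

(** Each monomial contributes 1 exactly when its exponent is N, so both sides are the length of
    [E_ON_list N]. *)
Lemma coef_partial_sum_E_ON (R : comUnitRingType) N
    (A : {fset {p : overpartition | E_ON p}}) :
  (forall p, weight (val p) = N -> p \in A) ->
  partial_sum (fun p : {p : overpartition | E_ON p} => fpsX R ^+ weight (val p)) A N
  = E_ON_gf R N N.
Proof.
move=> AN; rewrite /partial_sum -(big_seq_fsetE _ A predT (fun p => fpsX R ^+ weight (val p))).
rewrite /E_ON_gf [LHS]coef_fps_sum [RHS]coef_fps_sum.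
under [LHS]eq_bigr do rewrite coef_fpsXn eq_sym.
under [RHS]eq_bigr do rewrite coef_fps_sum.
rewrite pair_big_dep /=.
under [RHS]eq_bigr do rewrite coef_fpsXn eq_sym.
transitivity ((size (E_ON_list N))%:R : R).
  rewrite -(perm_size (E_ON_list_parts AN)) size_map size_filter.
  by rewrite -sum1_count natr_sum [RHS]big_mkcond; apply: eq_bigr => p _; case: eqP.
rewrite size_image -sum1_card natr_sum big_mkcondr /=.
by apply: eq_bigr => z _; case: eqP.
Qed.

Theorem mainTheorem10 (R : comUnitRingType) (q := fpsX R) :
  partial_sum (fun p : {p : overpartition | E_ON p} => q ^+ weight (val p))
    @ totally -->
  qpoch_inf (- q) q *
    (\big[+%R/0]_(0 <= n <oo)
       (q ^+ (2 * n + 1) / (1 - q ^+ (2 * n + 1)) *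
        (qpoch (q ^+ 2) (q ^+ 2) n)^-1))
  + (qpoch_inf q q)^-1 - qpoch_inf (- q) q.
Proof.
have FT := @totally_filter {p : overpartition | E_ON p}.
apply/fps_cvgP => N.
(* Once a finite set contains all elements of weight N, the coefficient of q^N of its partial sum no
   longer changes. *)
exists [fset p in E_ON_seq N]%fset => // A /fsubsetP A_N.
rewrite coef_partial_sum_E_ON; last first.
  by move=> p pN; apply: A_N; rewrite inE /= mem_E_ON_seq pN.
by have /fps_eqmodP -> := E_ON_gf_limit R N.
Qed.
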